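(* Let $S$ be a finitely generated semigroup, and let $T$ be a subsemigroup of $S$ such that $S\setminus T$ is finite. If $T$ is hopfian, then $S$ is hopfian.
   Context: A semigroup $S$ is hopfian if every surjective (semigroup) endomorphism $S\to S$ is an automorphism (equivalently, is injective). *)

(* Defs.v *)
From mathcomp Require Import all_boot all_classical.

Set Implicit Arguments.
Unset Strict Implicit.
Unset Printing Implicit Defensive.

Local Open Scope classical_set_scope.
Local Open Scope group_scope.

Definition subsemigroup (S : semigroupType) (A : set S) : Prop :=
  forall x y, A x -> A y -> A (x * y).

(* [smallest C X] is the intersection of all sets in [C] that contain [X], so
   here it is the subsemigroup of [S] generated by [X]. *)
Definition finitely_generated (S : semigroupType) : Prop :=
  exists2 X : set S, finite_set X & smallest (@subsemigroup S) X = [set: S].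

Definition hopfian (S : semigroupType) : Prop :=
  forall f : {multiplicative S -> S},
    set_surj [set: S] [set: S] f -> bijective f.

(* Main.v *)
Require Import Defs.
From HB Require Import structures.
From mathcomp Require Import all_boot all_classical.

Local Open Scope group_scope.
Local Open Scope classical_set_scope.

(* The finite complement of [A] carries a finite-index congruence [p] of [S] all
   of whose classes outside [A] are singletons. Since [S] is finitely generated,
   there are finitely many homomorphisms from [S] to the quotient, so
   [p \o f^i = p \o f^j] for some [i < j]; as [f] is surjective, this cancels to
   [p \o f^k = p] with [k = j - i > 0]. Hence [f^k] fixes the complement of [A]
   pointwise and maps no element of [A] outside [A], so it restricts to a
   surjective endomorphism of [A], which is injective because [A] is hopfian.
   Therefore [f^k], and with it [f], is injective. *)

(** The congruence is the kernel of [p], so [Q] can be a bare type without a product. *)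
Definition congruence_map {S : semigroupType} {Q : Type} (p : S -> Q) : Prop :=
  forall x x' y y', p x = p x' -> p y = p y' -> p (x * y) = p (x' * y').

Definition lmul_opt {S : semigroupType} {F : seq S}
    (u : option (seq_sub F)) (x : S) : S :=
  if u is Some v then val v * x else x.

Definition rmul_opt {S : semigroupType} {F : seq S}
    (x : S) (u : option (seq_sub F)) : S :=
  if u is Some v then x * val v else x.

(* The classes of [x] are separated by the two-sided contexts [u * x * v] with
   [u], [v] in the complement of [A] or absent, recording the value of the
   product only when it lies outside [A]. *)
Lemma cofinite_subsemigroup_congruence {S : semigroupType} {A : set S} :
  subsemigroup A -> finite_set (~` A) ->
  exists (Q : finType) (p : S -> Q),
    congruence_map p /\ forall x y, p x = p y -> ~ A x -> x = y.
Proof.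
move=> AM /finite_seqP[F AF].
have notA x : (x \in F) = false -> A x.
  move=> xF; apply: contrapT => nAx.
  have : [set` F] x by rewrite -AF.
  by rewrite /= xF.
have inA x : A x -> (x \in F) = false.
  by move=> Ax; apply/negP => xF; have : (~` A) x by rewrite AF.
pose O x : option (seq_sub F) := insub x.
have ON x : A x -> O x = None by move=> /inA xF; rewrite /O insubF.
have Oinj x y : O x = O y -> ~ A x -> x = y.
  move=> Oxy nAx; have xF : x \in F.
    by apply/negPn/negP => /negbTE /notA.
  move: Oxy; rewrite /O (insubT (fun z => z \in F) xF).
  by case: insubP => // u _ <- [<-].
have OA x y : O x = O y -> A x -> A y.
  move=> Oxy Ax; apply: contrapT => nAy.
  by apply: (nAy); rewrite (Oinj _ _ (esym Oxy) nAy).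
pose C := option (seq_sub F).
pose p x := [ffun uv : C * C => O (rmul_opt (lmul_opt uv.1 x) uv.2)].
have pP x y : p x = p y ->
    forall u v : C, O (rmul_opt (lmul_opt u x) v) = O (rmul_opt (lmul_opt u y) v).
  by move=> /ffunP pxy u v; have := pxy (u, v); rewrite !ffunE.
(* If [x] and [w] lie in [A], both products do and [O] sends them to [None]; if [x] is outside [A],
   then [x = y]. Only [w] in [F] remains. *)
have OMl w x y : O x = O y ->
    ((w \in F) -> O (w * x) = O (w * y)) -> O (w * x) = O (w * y).
  move=> Oxy wxy; case: (boolP (w \in F)) => [/wxy //|/negbTE/notA Aw].
  have [Ax|nAx] := pselect (A x); last by rewrite (Oinj _ _ Oxy nAx).
  by rewrite !ON //; apply: AM => //; apply: OA Oxy Ax.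
have OMr w x y : O x = O y ->
    ((w \in F) -> O (x * w) = O (y * w)) -> O (x * w) = O (y * w).
  move=> Oxy wxy; case: (boolP (w \in F)) => [/wxy //|/negbTE/notA Aw].
  have [Ax|nAx] := pselect (A x); last by rewrite (Oinj _ _ Oxy nAx).
  by rewrite !ON //; apply: AM => //; apply: OA Oxy Ax.
have lrA (u v : C) x :
    rmul_opt (lmul_opt u x) v = lmul_opt u (rmul_opt x v).
  by case: u v => [u|] [v|] //=; rewrite mulgA.
exists {ffun C * C -> C}, p.
split=> [x x' y y' /pP px /pP py|x y /pP pxy nAx]; last first.
  exact: Oinj (pxy None None) nAx.
(* Replace one factor at a time. The other factor, with its side of the context, is a single [w];
   when [w] is in [F], it is itself a context. *)
apply: (@etrans _ _ (p (x' * y))); apply/ffunP => -[u v]; rewrite !ffunE /=.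
  have E z : rmul_opt (lmul_opt u (z * y)) v = lmul_opt u z * rmul_opt y v.
    by case: u v => [u|] [v|] //=; rewrite !mulgA.
  rewrite !E; apply: OMr => [|wF]; first exact: (px u None).
  exact: (px u (Some (SeqSub wF))).
have E z : rmul_opt (lmul_opt u (x' * z)) v = lmul_opt u x' * rmul_opt z v.
  by case: u v => [u|] [v|] //=; rewrite !mulgA.
rewrite !E; apply: OMl => [|wF]; first exact: (py None v).
by have := py (Some (SeqSub wF)) v; rewrite !lrA.
Qed.

Lemma iter_gmulfM {S : semigroupType} (f : {multiplicative S -> S}) n :
  {morph iter n f : x y / x * y}.
Proof. by elim: n => // n IHn x y; rewrite !iterS IHn gmulfM. Qed.

Lemma iter_surj {X : Type} {f : X -> X} n :
  set_surj [set: X] [set: X] f -> forall y, exists x, iter n f x = y.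
Proof.
move=> fS; elim: n => [|n IHn] y; first by exists y.
by have [x _ <-] := fS y I; have [z <-] := IHn x; exists z; rewrite iterS.
Qed.

Lemma nat_fintype_collision {Q : finType} (c : nat -> Q) :
  exists i j, (i < j)%N /\ c i = c j.
Proof.
have /injectivePn[i [j ij cij]] : ~~ injectiveb (fun i : 'I_#|Q|.+1 => c i).
  apply/negP => /injectiveP /leq_card.
  by rewrite card_ord ltnn.
case: (ltngtP i j) => [lt|lt|/val_inj eqij].
- by exists i, j.
- by exists j, i.
- by rewrite eqij eqxx in ij.
Qed.

Lemma surjective_iter_mod_congruence {S : semigroupType} {Q : finType}
    {p : S -> Q} {f : {multiplicative S -> S}} :
  finitely_generated S -> congruence_map p ->
  set_surj [set: S] [set: S] f ->
  exists2 k, (0 < k)%N & forall x, p (iter k f x) = p x.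
Proof.
move=> [X /finite_seqP[s ->{X}] genS] pM fS.
pose c n := [ffun x : seq_sub s => p (iter n f (val x))].
have [i [j [ltij /ffunP cij]]] := nat_fintype_collision c.
have pij x : p (iter i f x) = p (iter j f x).
  have : [set: S] x by [].
  rewrite -genS; move: x.
  apply: (@smallest_sub _ _ _ [set x | p (iter i f x) = p (iter j f x)]).
    by move=> x y /= px py; rewrite !iter_gmulfM; apply: pM.
  by move=> x /= xs; have := cij (SeqSub xs); rewrite !ffunE.
exists (j - i)%N => [|x]; first by rewrite subn_gt0.
(* With [x] as the [i]-th iterate at [y], [j - i] further steps give the [j]-th iterate at [y]. *)
have [y <-] := iter_surj i fS x.
by rewrite -iterD subnK ?pij // ltnW.
Qed.

Lemma hopfian_restriction_inj {S : semigroupType} {A : set S}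
    {T : subSemigroupType [in A]} {h : S -> S} :
  {morph h : x y / x * y} -> hopfian T ->
  (forall x, A x -> A (h x)) -> (forall y, A y -> exists2 x, A x & h x = y) ->
  forall x y, A x -> A y -> h x = h y -> x = y.
Proof.
move=> hM hopT hA hS.
have valA (t : T) : A (val t) by apply: set_mem; exact: (valP t).
have liftT x : A x -> exists t : T, val t = x.
  by move=> Ax; exists (Sub x (mem_set Ax)); rewrite SubK.
(* The default [t] of [insubd] never occurs, since [h] maps [A] into [A]. *)
pose g (t : T) : T := insubd t (h (val t)).
have val_g t : val (g t) = h (val t).
  by rewrite insubdK //; apply: mem_set; apply: hA.
have gM : {morph g : x y / x * y}.
  by move=> x y; apply: val_inj; rewrite val_g !valM hM !val_g.
pose gm := HB.pack_for {multiplicative T -> T} g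
  (isMultiplicative.Build T T g gM).
have /bij_inj g_inj : bijective g.
  apply: (hopT gm) => t _; have [x Ax hx] := hS _ (valA t).
  have [u ux] := liftT x Ax.
  by exists u => //; apply: val_inj; rewrite /= val_g ux.
move=> x y /liftT[t <-] /liftT[u <-] htu.
by congr (val _); apply: g_inj; apply: val_inj; rewrite !val_g.
Qed.

(* [T] is the subsemigroup of [S] with underlying set [A], as a semigroup in its
   own right: its elements are those of [A] and [val : T -> S] is an injective
   homomorphism. *)
Theorem mainTheorem1 (S : semigroupType) (A : set S)
    (T : subSemigroupType [in A]) :
  finitely_generated S -> finite_set (~` A) -> hopfian T -> hopfian S.
Proof.
move=> fgS finA hopT f fS.
have AM : subsemigroup A.
  move=> x y Ax Ay; apply: set_mem.
  have := valP ((Sub x (mem_set Ax) : T) * (Sub y (mem_set Ay) : T)).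
  by rewrite valM !SubK.
have [Q [p [pM pA]]] := cofinite_subsemigroup_congruence AM finA.
have [k k_gt0 pk] := surjective_iter_mod_congruence fgS pM fS.
pose h := iter k f.
have h_fix x : ~ A x -> h x = x by move=> nAx; apply/esym/pA.
have h_fix' x : ~ A (h x) -> h x = x by exact: pA.
have hA x : A x -> A (h x).
  by move=> Ax; apply: contrapT => nAhx; apply: (nAhx); rewrite h_fix'.
have hS y : A y -> exists2 x, A x & h x = y.
  (* A preimage of [y] outside [A] would be fixed by [h], hence equal to [y]. *)
  move=> Ay; have [x hx] := iter_surj k fS y; exists x => //.
  by apply: contrapT => nAx; apply: (nAx); rewrite -(h_fix x nAx) /h hx.
have hAinj := hopfian_restriction_inj (iter_gmulfM f k) hopT hA hS.
have h_inj : injective h.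
  (* If one of the points is outside [A], it is the common value of [h], so the other is fixed
     too. *)
  move=> x y hxy; have [Ax|nAx] := pselect (A x); last first.
    by rewrite -(h_fix x nAx) hxy h_fix' // -hxy h_fix.
  have [Ay|nAy] := pselect (A y); first exact: hAinj.
  by rewrite -(h_fix y nAy) -hxy h_fix' // hxy h_fix.
have f_inj : injective f.
  move=> x y fxy; apply: h_inj; rewrite /h.
  (* As [k > 0], [h] factors through [f]. *)
  by case: k k_gt0 {pk h h_fix h_fix' hA hS hAinj} => // k _; rewrite !iterSr fxy.
rewrite -setTT_bijective; split => //.
by move=> x y _ _; apply: f_inj.
Qed.
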